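(* There is an absolute constant $C>0$ such that for every integer $n\ge 73$, $$\left| f\left(n, \left\lfloor \tfrac{n^2}{4}\right\rfloor+1\right) - \frac{2n^2}{33}\right| \le C n,$$ i.e. $f(n, \lfloor n^2/4\rfloor+1)=\frac{2n^2}{33}+O(n)$.
   Context: All graphs are finite and simple. For a graph $G$, $\overline{G}$ denotes its complement. Let $G$ be a $K_4$-free graph. An edge of $\overline{G}$ (i.e. a pair of non-adjacent vertices of $G$) is called a $K_4$-saturating edge if adding it to $G$ creates a copy of $K_4$. Let $f(G)$ denote the number of $K_4$-saturating edges of $G$. For integers $n,e$, let $f(n,e)$ denote the largest integer $\ell$ such that every $n$-vertex $K_4$-free graph with exactly $e$ edges has at least $\ell$ $K_4$-saturating edges. *)

(* Defs.v *)
From HB Require Import structures.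
From mathcomp Require Import all_boot all_order all_algebra.
From mathcomp Require Import reals.

Set Implicit Arguments.
Unset Strict Implicit.
Unset Printing Implicit Defensive.

Record sgraph := SGraph {
  vertex :> finType;
  adj : rel vertex;
  adj_sym : symmetric adj;
  adj_irrefl : irreflexive adj }.

Definition edges (G : sgraph) : {set {set G}} :=
  [set [set p.1; p.2] | p : G * G & adj p.1 p.2].

Section Complement.
Variable G : sgraph.

Definition compl_adj : rel G := fun x y => (x != y) && ~~ adj x y.

Lemma compl_adj_sym : symmetric compl_adj.
Proof. by move=> x y; rewrite /compl_adj eq_sym adj_sym. Qed.

Lemma compl_adj_irrefl : irreflexive compl_adj.
Proof. by move=> x; rewrite /compl_adj eqxx. Qed.

Definition compl : sgraph := SGraph compl_adj_sym compl_adj_irrefl.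

End Complement.

Section AddEdge.
Variables (G : sgraph) (e : {set G}).

Definition add_edge_adj : rel G :=
  fun x y => adj x y || (x != y) && (e == [set x; y]).

Lemma add_edge_adj_sym : symmetric add_edge_adj.
Proof. by move=> x y; rewrite /add_edge_adj adj_sym eq_sym setUC. Qed.

Lemma add_edge_adj_irrefl : irreflexive add_edge_adj.
Proof. by move=> x; rewrite /add_edge_adj adj_irrefl eqxx. Qed.

Definition add_edge : sgraph := SGraph add_edge_adj_sym add_edge_adj_irrefl.

End AddEdge.

Definition clique (G : sgraph) (A : {set G}) : bool :=
  [forall x in A, forall y in A, (x != y) ==> adj x y].

Definition has_K4 (G : sgraph) : bool :=
  [exists A : {set G}, (#|A| == 4) && clique A].

Definition K4_saturating_edges (G : sgraph) : {set {set G}} :=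
  [set e : {set G} in edges (compl G) | has_K4 (add_edge e)].

Definition num_K4_saturating (G : sgraph) : nat := #|K4_saturating_edges G|.

Definition K4_saturating_bound (n e l : nat) : Prop :=
  forall G : sgraph, #|G| = n -> #|edges G| = e -> ~~ has_K4 G ->
    l <= num_K4_saturating G.

(* [is_min_K4_saturating n e l] says f(n, e) = l. It is a relation because
   no largest bound exists when there is no K4-free graph with n vertices
   and e edges. *)
Definition is_min_K4_saturating (n e l : nat) : Prop :=
  K4_saturating_bound n e l /\
  forall l' : nat, K4_saturating_bound n e l' -> l' <= l.

(* Main.v *)
(* Lower bound.  Take a largest family of t vertex-disjoint triangles in G, and let F be the
   set of the m = n - 3t remaining vertices; G[F] is triangle-free.  A vertex u outside a
   triangle T has at most two neighbours in T, and when it has two, u and the third vertex of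
   T form a saturating pair.  Hence every edge touching the triangles beyond the trivial
   "one per vertex and triangle" yields a saturating pair; as G[F] has at most m^2/4 edges,
   at least nt/2 - 3t^2/4 - O(n) saturating pairs touch the triangles.  By averaging, some
   triangle xyz of the family has E >= n/2 - 9t/4 common neighbours of two of its vertices
   in F.  They split into three classes X, Y, Z whose inner pairs are all saturating.  If one
   class is empty, these are about E^2/4 further pairs, and minimising over t gives
   2n^2/33, attained at t = 2n/33.  If no class is empty, maximality of the family makes the
   neighbourhoods of x, y and z in F independent, so G[F] misses many edges of the Mantel
   bound, or one class is large; both improve the count.

   Upper bound.  Take a balanced complete bipartite graph on P and Q, and join an independent
   set Z of 2n/33 vertices to 8n/33 vertices of P and of Q.  All saturating pairs lie inside
   Z, or inside one of the two sets joined to Z. *)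
Require Import Defs.
From HB Require Import structures.
From mathcomp Require Import all_boot all_order all_algebra.
From mathcomp Require Import boolp reals.
From mathcomp Require Import lra zify.
Import Order.TTheory GRing.Theory Num.Theory.

Set Implicit Arguments.
Unset Strict Implicit.
Unset Printing Implicit Defensive.

(** * Numerical inequalities *)

Section Numerical.
Local Open Scope ring_scope.

(* Here m = n - 3t.  After completing the square the difference of the two sides at
   E = m/2 - 3t/4 is (m - 27t/2)^2 / 132, which vanishes at t = 2n/33. *)
Lemma two_class_bound (R : realFieldType) (m t E : R) :
  0 <= m -> 0 <= t -> 2 * m <= 4 * E + 3 * t ->
  8 / 33 * (m + 3 * t) ^+ 2 <= 2 * m * t + 3 * t ^+ 2 + E ^+ 2.
Proof.
move=> m0 t0 hE.
have [hmt|hmt] := lerP (3 * t) (2 * m).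
  have hE2 : (m / 2 - 3 * t / 4) ^+ 2 <= E ^+ 2 by apply: lerXn2r; rewrite ?nnegrE; lra.
  have := sqr_ge0 (m - 27 / 2 * t); nra.
(* For [2 * m < 3 * t] the hypothesis gives no positive lower bound on [E], and
   [2 * m * t + 3 * t ^+ 2] suffices alone. *)
have := sqr_ge0 E.
have : 0 <= (3 * t - 2 * m) * t by apply: mulr_ge0; lra.
have : 0 <= (3 * t - 2 * m) * m by apply: mulr_ge0; lra.
have : 0 <= m * t by exact: mulr_ge0.
nra.
Qed.

(* a, b, c are the sizes of the three classes, o is the number of vertices of F with no
   neighbour in the triangle, and D plays the role of m^2 - 4 e(F). *)
Lemma three_class_bound (R : realFieldType) (m t a b c o D : R) :
  0 <= m -> 0 <= t -> 0 <= a -> 0 <= o -> b <= a -> c <= a ->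
  2 * m + 4 * o <= 4 * (a + b + c) + 3 * t -> 0 <= D ->
  0 <= b -> 0 <= c ->
  m ^+ 2 - 4 * (a * (m - (a + b + c) - o) + (a + b + c) * o)
    - (m - (a + b + c)) ^+ 2 <= D ->
  8 / 33 * (m + 3 * t) ^+ 2
    <= 2 * m * t + 3 * t ^+ 2 + D + 2 * (a ^+ 2 + b ^+ 2 + c ^+ 2).
Proof.
move=> m0 t0 a0 o0 ba ca hE D0 b0 c0 hD.
set E := a + b + c in hE hD *.
have bc : (E - a) ^+ 2 <= 2 * (b ^+ 2 + c ^+ 2).
  by have := sqr_ge0 (b - c); rewrite /E; nra.
have E3 : 2 * E ^+ 2 <= 6 * (a ^+ 2 + b ^+ 2 + c ^+ 2).
  have := sqr_ge0 (b - c); have := sqr_ge0 (a - c); have := sqr_ge0 (b - a).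
  by rewrite /E; nra.
(* [hE] reads [d + o <= E]: [d] is the guaranteed total size of the classes, and the excess
   [r = E - d] introduced below bounds [o]. *)
pose d := m / 2 - 3 * t / 4.
have [d0|d0] := lerP d 0.
  have := @two_class_bound R m t 0 m0 t0; rewrite /d in d0.
  have : 0 <= a ^+ 2 + b ^+ 2 + c ^+ 2 by rewrite !addr_ge0 ?sqr_ge0.
  move=> h1 h2; have := h2 ltac:(lra); lra.
(* (5/4)^2 * 2/3 >= 1, so a large [E] reduces to the two-class bound. *)
have [big|small] := lerP (5 / 4 * d) E.
  have : (5 / 4 * d) ^+ 2 <= E ^+ 2 by apply: lerXn2r; rewrite ?nnegrE //; lra.
  have := @two_class_bound R m t d m0 t0; rewrite /d in d0 *.
  move=> h1 h2; have := h1 ltac:(lra).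
  have := sqr_ge0 (m / 2 - 3 * t / 4); lra.
pose r := E - d.
have r0 : 0 <= r by rewrite /r /d; lra.
have or : o <= r by rewrite /r /d; lra.
have rd : 4 * r <= d by rewrite /r; lra.
have md : 2 * d <= m by rewrite /d; lra.
have aE : a <= E by rewrite /E; lra.
(* The left side of [hD] does not increase with [o], since [a <= E], so [o] may be raised to [r]. *)
have hD' : m ^+ 2 - 4 * (a * (m - E - r) + E * r) - (m - E) ^+ 2 <= D.
  have : 0 <= (r - o) * (E - a) by apply: mulr_ge0; lra.
  move: hD; nra.
have tE : t = 4 / 3 * (m / 2 - d) by rewrite /d; lra.
have EE : E = d + r by rewrite /r; lra.
(* With the weight 1/3 on [hD'], the difference of the two sides is a quadratic in [a] with
   its minimum at (2m + d - r)/9; the remaining form in m, d, r is nonnegative on the cone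
   0 <= 4r <= d, 2d <= m. *)
have := sqr_ge0 (a - (2 * m + d - r) / 9).
have : 0 <= r * (d - 4 * r) by apply: mulr_ge0; lra.
have : 0 <= r * (m - 2 * d) by apply: mulr_ge0; lra.
have : 0 <= d * (m - 2 * d) by apply: mulr_ge0; lra.
have : 0 <= d * r by apply: mulr_ge0; lra.
have := sqr_ge0 (m - 2 * d).
have hs : 0 <= 2 * D / 3 by lra.
clearbody E d r; subst t E.
clear E3 hD hE ba ca.
move: hD' bc; nra.
Qed.

(** [S] stands for the number of saturating pairs, [s] and [sFF] for the ordered ones touching the
    triangles and inside F, [FF] for the ordered adjacent pairs inside F. The hypotheses give
    [4 * S >= 2 * m * t + 3 * t ^+ 2 + E ^+ 2] up to an error [6 * t + 2 * E], which the term
    [m + 3 * t] on the right absorbs. *)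
Lemma two_class_total (R : realFieldType) (m t S s sFF FF E : R) :
  0 <= m -> 0 <= t -> s + sFF <= 2 * S ->
  (m + 3 * t) ^+ 2 <= 2 * s + 6 * t ^+ 2 + 6 * t + 4 * t * m + 2 * FF ->
  2 * FF <= m ^+ 2 -> 2 * m <= 4 * E + 3 * t -> E <= m ->
  E ^+ 2 <= 2 * sFF + 2 * E ->
  2 * (m + 3 * t) ^+ 2 <= 33 * (S + (m + 3 * t)).
Proof.
move=> m0 t0 hS hs hFF hE Em hF.
have := two_class_bound m0 t0 hE; move: m0 t0 hS hs hFF Em hF; clear=> *; lra.
Qed.

(** Unlike with two classes, the deficit [m ^+ 2 - 2 * FF] is kept, as the [D] of
    [three_class_bound]; [w] counts the vertices of F outside the classes. *)
Lemma three_class_total (R : realFieldType) (t S s sFF FF a b c o w : R) :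
  let m := a + b + c + w in
  0 <= a -> 0 <= b -> 0 <= c -> 0 <= o -> 0 <= w -> 0 <= t -> s + sFF <= 2 * S ->
  (m + 3 * t) ^+ 2 <= 2 * s + 6 * t ^+ 2 + 6 * t + 4 * t * m + 2 * FF ->
  2 * FF <= m ^+ 2 -> 2 * m + 4 * o <= 4 * (a + b + c) + 3 * t ->
  a ^+ 2 + b ^+ 2 + c ^+ 2 <= sFF + (a + b + c) -> b <= a -> c <= a ->
  2 * FF + 4 * a * o <= 4 * (a * w + (a + b + c) * o) + w ^+ 2 ->
  2 * (m + 3 * t) ^+ 2 <= 33 * (S + (m + 3 * t)).
Proof.
move=> m a0 b0 c0 o0 w0 t0 hS hs hFF hE hF ba ca hFF2.
have m0 : 0 <= m by rewrite !addr_ge0.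
have D0 : 0 <= m ^+ 2 - 2 * FF by rewrite subr_ge0.
have hD : m ^+ 2 - 4 * (a * (m - (a + b + c) - o) + (a + b + c) * o)
    - (m - (a + b + c)) ^+ 2 <= m ^+ 2 - 2 * FF.
  have -> : m - (a + b + c) = w by rewrite /m addrAC subrr add0r.
  by move: hFF2; clear=> *; lra.
have := three_class_bound m0 t0 a0 o0 ba ca hE D0 b0 c0 hD.
have Em : a + b + c <= m by rewrite lerDl.
clear D0 hD hE hFF hFF2; move: hS hs hF t0 m0 Em; move: m => m'; clear=> *; lra.
Qed.

End Numerical.

(** * Integer versions of the bounds *)

Lemma two_class_nat (n m t S s sFF FF E : nat) :
  n = m + 3 * t -> 2 * S >= s + sFF ->
  n ^ 2 <= 2 * s + 6 * t ^ 2 + 6 * t + 4 * t * m + 2 * FF -> 2 * FF <= m ^ 2 ->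
  2 * m <= 4 * E + 3 * t -> E <= m -> E ^ 2 <= 2 * sFF + 2 * E ->
  2 * n ^ 2 <= 33 * (S + n).
Proof.
move=> ->; rewrite -!(ler_nat rat) !(natrD, natrM, natrX); move=> *.
by apply: (@two_class_total rat m%:R t%:R S%:R s%:R sFF%:R FF%:R E%:R).
Qed.

Lemma three_class_nat (n m t S s sFF FF a b c o w : nat) :
  n = m + 3 * t -> 2 * S >= s + sFF ->
  n ^ 2 <= 2 * s + 6 * t ^ 2 + 6 * t + 4 * t * m + 2 * FF -> 2 * FF <= m ^ 2 ->
  2 * m + 4 * o <= 4 * (a + b + c) + 3 * t -> m = a + b + c + w ->
  a ^ 2 + b ^ 2 + c ^ 2 <= sFF + (a + b + c) -> b <= a -> c <= a ->
  2 * FF + 4 * a * o <= 4 * (a * w + (a + b + c) * o) + w ^ 2 ->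
  2 * n ^ 2 <= 33 * (S + n).
Proof.
move=> -> hS hs hFF hE Em; rewrite Em in hs hFF hE *; move: hS hs hFF hE.
rewrite -!(ler_nat rat) !(natrD, natrM, natrX); move=> *.
by apply: (@three_class_total rat t%:R S%:R s%:R sFF%:R FF%:R a%:R b%:R c%:R o%:R w%:R).
Qed.

(** The hypotheses are symmetric in the three classes, so these can be relabelled to make the first
    one the largest. *)
Lemma three_class_max_nat (n m t S s sFF FF a b c o w : nat) :
  let M := maxn a (maxn b c) in
  n = m + 3 * t -> 2 * S >= s + sFF ->
  n ^ 2 <= 2 * s + 6 * t ^ 2 + 6 * t + 4 * t * m + 2 * FF -> 2 * FF <= m ^ 2 ->
  2 * m + 4 * o <= 4 * (a + b + c) + 3 * t -> m = a + b + c + w ->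
  a ^ 2 + b ^ 2 + c ^ 2 <= sFF + (a + b + c) ->
  2 * FF + 4 * M * o <= 4 * (M * w + (a + b + c) * o) + w ^ 2 ->
  2 * n ^ 2 <= 33 * (S + n).
Proof.
move=> M hn hS hs hFF hE Em hF; rewrite /M => {M}.
have [le|/ltnW le] := leqP a (maxn b c); last first.
  move: le; rewrite geq_max => /andP[ba ca] hFF2.
  exact: three_class_nat hn hS hs hFF hE Em hF ba ca hFF2.
move: le; have [le /[dup] ab _|/ltnW le /[dup] ab _] := leqP b c => hFF2.
  have rot i j l : l + i + j = i + j + l by rewrite -addnA addnC.
  by apply: (@three_class_nat n m t S s sFF FF c a b o w hn hS hs hFF _ _ _ ab le);
    rewrite ?(rot a b c) ?(rot (a ^ 2) (b ^ 2) (c ^ 2)).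
have sw i j l : j + i + l = i + j + l by rewrite [j + i]addnC.
by apply: (@three_class_nat n m t S s sFF FF b a c o w hn hS hs hFF _ _ _ ab le);
  rewrite ?(sw a b) ?(sw (a ^ 2)).
Qed.

(** For a triangle sending [c] edges into F, with [o] vertices of F missed and [e] joined to two
    corners, a large [c] forces a large [e]. *)
Lemma weight_balance (c o m e t : nat) :
  c + o = m + e -> 6 * m < 4 * c + 3 * t -> 2 * m + 4 * o <= 4 * e + 3 * t.
Proof. lia. Qed.

Lemma sqrn_sum_two (a b c s : nat) : a ^ 2 + b ^ 2 + c ^ 2 <= s + (a + b + c) ->
  [|| a == 0, b == 0 | c == 0] -> (a + b + c) ^ 2 <= 2 * s + 2 * (a + b + c).
Proof.
have [ab _] := nat_Cauchy a b; have [ac _] := nat_Cauchy a c; have [bc _] := nat_Cauchy b c.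
by move=> h /or3P[]/eqP z; subst; move: ab ac bc h; rewrite ?addn0 ?add0n ?sqrnD; lia.
Qed.

(** * Counting ordered pairs *)

Section OrderedPairs.
Variables (T : finType) (r : rel T).
Implicit Types A B C : {set T}.

Definition count_pairs A B : nat := \sum_(x in A) \sum_(y in B) r x y.

Lemma count_pairsC A B : symmetric r -> count_pairs A B = count_pairs B A.
Proof.
by move=> rS; rewrite /count_pairs exchange_big; do 2!apply: eq_bigr => ? _; rewrite rS.
Qed.

Lemma count_pairsUr A B C : [disjoint B & C] ->
  count_pairs A (B :|: C) = count_pairs A B + count_pairs A C.
Proof.
move=> dBC; rewrite /count_pairs -big_split; apply: eq_bigr => x _.
by rewrite -bigU //; apply: eq_bigl => y; rewrite inE.
Qed.

Lemma count_pairs_square A B C : symmetric r -> [disjoint B & C] -> A = B :|: C ->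
  count_pairs A A = count_pairs B B + 2 * count_pairs C B + count_pairs C C.
Proof.
move=> rS dBC ->; rewrite count_pairsUr // ![count_pairs (_ :|: _) _]count_pairsC //.
by rewrite !count_pairsUr // (count_pairsC B C) //; lia.
Qed.

Lemma count_pairs_coverr (P : {set {set T}}) A : trivIset P ->
  count_pairs A (cover P) = \sum_(B in P) count_pairs A B.
Proof.
move=> tP; rewrite /count_pairs [RHS]exchange_big /=; apply: eq_bigr => x _.
by rewrite big_trivIset.
Qed.

Lemma count_pairs_coverl (P : {set {set T}}) A : trivIset P ->
  count_pairs (cover P) A = \sum_(B in P) count_pairs B A.
Proof. by move=> tP; rewrite /count_pairs big_trivIset. Qed.

Lemma count_pairs_eq0 A B : {in A & B, forall x y, ~~ r x y} -> count_pairs A B = 0.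
Proof.
move=> h; apply: big1 => x xA; apply: big1 => y yB.
by rewrite (negPf (h x y xA yB)).
Qed.

Lemma count_pairs_subr A B C : B \subset C -> count_pairs A B <= count_pairs A C.
Proof.
move=> sBC; apply: leq_sum => x _; rewrite [leqRHS](big_setID B) /=.
by rewrite (setIidPr sBC) leq_addr.
Qed.

(** The map from ordered pairs to two-element sets is exactly two-to-one: irreflexivity separates
    the two orders and symmetry supplies both. *)
Lemma card_unordered_pairs : symmetric r -> irreflexive r ->
  2 * #|[set [set p.1; p.2] | p : T * T & r p.1 p.2]| = count_pairs setT setT.
Proof.
move=> rS rI.
have -> : count_pairs setT setT = \sum_(p : T * T | r p.1 p.2) 1.
  rewrite /count_pairs pair_big /= [RHS]big_mkcond /=.
  by apply: eq_big => [p|p _]; rewrite ?inE //; case: (r _ _).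
pose f (p : T * T) := [set p.1; p.2].
transitivity (\sum_(p in [set p : T * T | r p.1 p.2]) 1); last first.
  by apply: eq_bigl => p; rewrite inE.
rewrite (partition_big_imset f) /=.
rewrite mulnC -sum_nat_const; apply: eq_big => // e; case/imsetP => -[x y].
rewrite inE /= => rxy ->; rewrite sum1_card.
have xy : x != y by apply: contraL rxy => /eqP ->; rewrite rI.
rewrite (_ : #|_| = #|[set (x, y); (y, x)]|).
  by rewrite cards2 xpair_eqE (negPf xy).
apply: eq_card => -[u v]; rewrite !inE !xpair_eqE /f /= unfold_in /= inE /=.
apply/andP/idP => [[ruv /eqP E]|].
  have uv : u != v by apply: contraL ruv => /eqP ->; rewrite rI.
  have : u \in [set x; y] by rewrite -E !inE eqxx.
  have : v \in [set x; y] by rewrite -E !inE eqxx orbT.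
  rewrite !inE => /orP[]/eqP ? /orP[]/eqP ?; subst => //; rewrite ?eqxx ?orbT //.
  - by rewrite eqxx in uv.
  - by rewrite eqxx in uv.
case/orP=> /andP[/eqP -> /eqP ->]; first by rewrite rxy.
by rewrite rS rxy setUC.
Qed.

End OrderedPairs.

Lemma count_pairs_sub (T : finType) (r : rel T) (A B : {set T}) :
  A \subset B -> count_pairs r A A <= count_pairs r B B.
Proof.
move=> sAB; apply: leq_trans (count_pairs_subr r A sAB) _.
by rewrite /count_pairs [leqRHS](big_setID A) /= (setIidPr sAB) leq_addr.
Qed.

Lemma count_pairs_disjoint (T : finType) (r : rel T) (A B C : {set T}) :
  symmetric r -> [disjoint A & B] -> A :|: B \subset C ->
  count_pairs r A A + count_pairs r B B <= count_pairs r C C.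
Proof.
move=> rS dAB /(count_pairs_sub r); apply: leq_trans.
by rewrite (count_pairs_square rS dAB erefl); lia.
Qed.

Lemma count_pairs_clique (T : finType) (r : rel T) (A : {set T}) :
  {in A &, forall x y, x != y -> r x y} -> #|A| ^ 2 <= count_pairs r A A + #|A|.
Proof.
move=> cA; rewrite -[X in _ + X]sum1_card -big_split /=.
rewrite -mulnn -sum_nat_const; apply: leq_sum => x xA.
rewrite (cardsD1 x) xA addnC leq_add2r -sum1_card [leqRHS](big_setD1 x) //=.
apply: leq_trans (leq_addl _ _); apply: leq_sum => y; rewrite !inE => /andP[yx yA].
by rewrite cA // eq_sym.
Qed.

Lemma sum_set3 (T : finType) (x y z : T) (f : T -> nat) :
  x != y -> x != z -> y != z -> \sum_(v in [set x; y; z]) f v = f x + f y + f z.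
Proof.
move=> xy xz yz; rewrite setUC big_setU1 ?inE ?negb_or ?[z == _]eq_sym ?xz //=.
by rewrite big_setU1 ?inE //= big_set1 addnC.
Qed.

Lemma sum_mem_bool (T : finType) (A : {set T}) (p : pred T) :
  \sum_(x in A) p x = #|[set x in A | p x]|.
Proof.
rewrite -sum1_card [LHS]big_mkcond [RHS]big_mkcond; apply: eq_bigr => x _.
by rewrite inE; case: (x \in A); case: (p x).
Qed.

(** * Saturating pairs in K4-free graphs *)

Section K4Free.
Variable G : sgraph.
Implicit Types (x y z u v : G) (A B T : {set G}).

(** The ordered-pair form of [K4_saturating_edges], with the other two vertices of the new K4 as
    witnesses; [K4_saturating_edgesE] shows the agreement in K4-free graphs. *)
Definition saturated : rel G := fun x y =>
  [&& x != y, ~~ adj x y &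
      [exists u, exists v, [&& adj x u, adj x v, adj y u, adj y v & adj u v]]].

Lemma saturatedI x y u v : x != y -> ~~ adj x y ->
  adj x u -> adj x v -> adj y u -> adj y v -> adj u v -> saturated x y.
Proof.
move=> xy nxy xu xv yu yv uv; rewrite /saturated xy nxy.
by apply/existsP; exists u; apply/existsP; exists v; rewrite xu xv yu yv uv.
Qed.

Lemma saturated_sym : symmetric saturated.
Proof.
move=> x y; rewrite /saturated eq_sym adj_sym; congr [&& _, _ & _].
by do 2!apply: eq_existsb => ?; do !case: (adj _ _).
Qed.

Lemma saturated_irrefl : irreflexive saturated.
Proof. by move=> x; rewrite /saturated eqxx. Qed.

Lemma adj_neq x y : adj x y -> x != y.
Proof. by apply: contraL => /eqP ->; rewrite adj_irrefl. Qed.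

Lemma card_edges : 2 * #|edges G| = count_pairs (@adj G) setT setT.
Proof. by rewrite -card_unordered_pairs //; [exact: adj_sym|exact: adj_irrefl]. Qed.

Definition triangle T := (#|T| == 3) && clique T.

Lemma triangleP T : triangle T ->
  exists x y z, [/\ T = [set x; y; z], adj x y, adj x z & adj y z].
Proof.
case/andP=> /eqP c3 /forall_inP cT.
have [x xT] : exists x, x \in T by apply/card_gt0P; rewrite c3.
have : #|T :\ x| == 2 by have := cardsD1 x T; rewrite xT c3; lia.
case/cards2P=> y [z [yz E]].
have yT : y \in T :\ x by rewrite E !inE eqxx.
have zT : z \in T :\ x by rewrite E !inE eqxx orbT.
move: yT zT; rewrite !inE => /andP[yx yT] /andP[zx zT].
exists x, y, z; split.
- by rewrite -(setD1K xT) E setUA.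
- by move: (cT x xT) => /forall_inP/(_ y yT)/implyP; apply; rewrite eq_sym.
- by move: (cT x xT) => /forall_inP/(_ z zT)/implyP; apply; rewrite eq_sym.
- by move: (cT y yT) => /forall_inP/(_ z zT)/implyP; apply.
Qed.

Lemma triangle_set3 x y z : adj x y -> adj x z -> adj y z -> triangle [set x; y; z].
Proof.
move=> xy xz yz; apply/andP; split.
  by rewrite setUC cardsU1 cards2 !inE negb_or ![z == _]eq_sym !adj_neq.
apply/forall_inP => u; rewrite !inE => uT; apply/forall_inP => v; rewrite !inE => vT.
apply/implyP; move: uT vT => /orP[/orP[]|]/eqP-> /orP[/orP[]|]/eqP->;
  by rewrite ?eqxx // ?xy ?xz ?yz // adj_sym ?xy ?xz ?yz.
Qed.

Definition triangle_free A :=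
  {in A & A & A, forall x y z, ~~ [&& adj x y, adj x z & adj y z]}.

(** Mantel's theorem by maximum degree: the neighbourhood [I] of a vertex of largest degree in [A]
    is independent, so every edge has an end in [A :\: I], where degrees are at most [#|I|]. Pairs
    being ordered, the left side is four times the number of edges. *)
Lemma mantel A : triangle_free A -> 2 * count_pairs (@adj G) A A <= #|A| ^ 2.
Proof.
move=> tfA; have [->|[w wA]] := set_0Vmem A.
  by rewrite /count_pairs big_set0.
pose d x := \sum_(y in A) adj x y.
case: (arg_maxnP d wA) => x xA dmax.
pose I := [set y in A | adj x y].
have dI : d x = #|I|.
  rewrite /d -sum1_card [LHS]big_mkcond [RHS]big_mkcond; apply: eq_bigr => y _.
  by rewrite inE; case: (y \in A); case: (adj x y).
have IA : I \subset A by apply/subsetP => y; rewrite inE => /andP[].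
have dj : [disjoint I & A :\: I].
  rewrite -setI_eq0; apply/eqP/setP => y; rewrite !inE.
  by case: (y \in A); case: (adj x y).
have EA : A = I :|: A :\: I by rewrite -{1}(setID A I) (setIidPr IA).
have I0 : count_pairs (@adj G) I I = 0.
  apply: count_pairs_eq0 => u v; rewrite !inE => /andP[uA xu] /andP[vA xv].
  by have := tfA x u v xA uA vA; rewrite xu xv.
have up : count_pairs (@adj G) (A :\: I) A <= #|A :\: I| * #|I|.
  rewrite -sum_nat_const; apply: leq_sum => y; rewrite inE => /andP[_ yA].
  by rewrite -dI; exact: dmax.
have cA : #|A| = #|I| + #|A :\: I| by rewrite -(cardsID I A) (setIidPr IA).
rewrite (count_pairs_square (@adj_sym G) dj EA) I0 cA.
have : count_pairs (@adj G) (A :\: I) I + count_pairs (@adj G) (A :\: I) (A :\: I)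
    <= #|A :\: I| * #|I| by rewrite -count_pairsUr // -EA.
move: (count_pairs _ _ I) (count_pairs _ _ (A :\: I)) #|I| #|A :\: I| => p q i j h.
have : (0 <= (i%:Z - j%:Z) ^+ 2)%R by exact: sqr_ge0.
nia.
Qed.

Hypothesis K4f : ~~ has_K4 G.

Lemma K4_freeP x y u v :
  adj x y -> adj x u -> adj x v -> adj y u -> adj y v -> adj u v -> False.
Proof.
move=> xy xu xv yu yv uv; apply: (negP K4f).
apply/existsP; exists (v |: [set x; y; u]).
have /andP[/eqP c3 /forall_inP c] := triangle_set3 xy xu yu.
rewrite cardsU1 c3 !inE !negb_or ![v == _]eq_sym !adj_neq //=.
have vP w : w \in [set x; y; u] -> adj v w.
  by rewrite !inE => /orP[/orP[]|]/eqP->; rewrite adj_sym.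
apply/forall_inP => a; rewrite in_setU1 => /orP[/eqP->|aT]; apply/forall_inP => b;
  rewrite in_setU1 => /orP[/eqP->|bT]; apply/implyP.
- by rewrite eqxx.
- by rewrite vP.
- by rewrite adj_sym vP.
by move: (c a aT) => /forall_inP/(_ b bT)/implyP.
Qed.

(** A K4 created by adding xy must contain both [x] and [y], or it would already lie in [G]; its two
    other vertices are the witnesses. *)
Lemma saturated_of_add_edge x y A : x != y -> ~~ adj x y -> #|A| = 4 ->
  {in A &, forall u v, u != v -> adj u v || ([set x; y] == [set u; v])} ->
  saturated x y.
Proof.
move=> xy nxy A4 cA'.
have inxy u v : [set x; y] == [set u; v] -> (x \in [set u; v]) && (y \in [set u; v]).
  by move=> /eqP <-; rewrite !inE !eqxx orbT.
have [xyA|] := boolP ((x \in A) && (y \in A)); last first.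
  move=> nA; case/negP: K4f; apply/existsP; exists A; rewrite A4 eqxx /=.
  apply/forall_inP => u uA; apply/forall_inP => v vA; apply/implyP => uv.
  case/orP: (cA' u v uA vA uv) => // /inxy; rewrite !inE => /andP[a b].
  case/negP: nA; apply/andP; split.
    by case/orP: a => /eqP ->.
  by case/orP: b => /eqP ->.
case/andP: xyA => xA yA.
have : #|A :\ x :\ y| == 2.
  have := cardsD1 x A; rewrite xA A4 => h.
  by have := cardsD1 y (A :\ x); rewrite !inE [y == x]eq_sym xy yA /=; lia.
case/cards2P=> u [v [uv E]].
have : u \in A :\ x :\ y by rewrite E !inE eqxx.
have : v \in A :\ x :\ y by rewrite E !inE eqxx orbT.
rewrite !inE => /and3P[vy vx vA] /and3P[uy ux uA].
apply: (@saturatedI x y u v) => //.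
- have := cA' x u xA uA; rewrite eq_sym ux => /(_ isT)/orP[] // /inxy.
  by rewrite !inE ![y == _]eq_sym (negPf xy) (negPf uy) /= andbF.
- have := cA' x v xA vA; rewrite eq_sym vx => /(_ isT)/orP[] // /inxy.
  by rewrite !inE ![y == _]eq_sym (negPf xy) (negPf vy) /= andbF.
- have := cA' y u yA uA; rewrite eq_sym uy => /(_ isT)/orP[] // /inxy.
  by rewrite !inE ![x == _]eq_sym [y == x]eq_sym (negPf xy) (negPf ux).
- have := cA' y v yA vA; rewrite eq_sym vy => /(_ isT)/orP[] // /inxy.
  by rewrite !inE ![x == _]eq_sym [y == x]eq_sym (negPf xy) (negPf vx).
have := cA' u v uA vA uv => /orP[] // /inxy.
by rewrite !inE ![x == _]eq_sym (negPf ux) (negPf vx).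
Qed.

Lemma K4_saturating_edgesE : K4_saturating_edges G =
  [set [set p.1; p.2] | p : G * G & saturated p.1 p.2].
Proof.
apply/setP => e; rewrite inE; apply/andP/imsetP.
  case=> /imsetP[[x y]]; rewrite inE /= => /andP[xy nxy] -> {e}.
  case/existsP=> A /andP[/eqP A4 /forall_inP cA]; exists (x, y) => //; rewrite inE /=.
  apply: (@saturated_of_add_edge x y A) => // u v uA vA uv.
  by move: (cA u uA) => /forall_inP/(_ v vA)/implyP/(_ uv); rewrite /= /add_edge_adj uv.
case=> -[x y]; rewrite inE /= => sxy -> {e}; have := sxy.
case/and3P=> xy nxy /existsP[u /existsP[v /and5P[xu xv yu yv uv]]].
split; first by apply/imsetP; exists (x, y); rewrite // inE /= /compl_adj xy nxy.
have c4 : #|v |: [set x; y; u]| == 4.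
  rewrite cardsU1 !inE !negb_or setUC cardsU1 !inE negb_or cards2 xy.
  by rewrite ![v == _]eq_sym [u == x]eq_sym [u == y]eq_sym !adj_neq.
apply/existsP; exists (v |: [set x; y; u]); apply/andP; split; first exact: c4.
apply/forall_inP => a; rewrite !inE => aT; apply/forall_inP => b; rewrite !inE => bT.
apply/implyP => /=; rewrite /add_edge_adj => ab; rewrite ab /=.
case/orP: aT ab => [/eqP->|/orP[/orP[]|]/eqP->];
  case/orP: bT => [/eqP->|/orP[/orP[]|]/eqP->]; rewrite ?eqxx //;
  rewrite ?xu ?xv ?yu ?yv ?uv // => _; rewrite ?eqxx ?orbT // 1?adj_sym ?xu ?xv ?yu ?yv ?uv //.
by rewrite setUC eqxx orbT.
Qed.

Lemma num_K4_saturatingE : 2 * num_K4_saturating G = count_pairs saturated setT setT.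
Proof.
rewrite -card_unordered_pairs; last 2 first.
- exact: saturated_sym.
- exact: saturated_irrefl.
by rewrite /num_K4_saturating K4_saturating_edgesE.
Qed.

End K4Free.

(** * Triangles in K4-free graphs *)

Section K4FreeBounds.
Variable G : sgraph.
Hypothesis K4f : ~~ has_K4 G.
Implicit Types (x y z u v : G) (A B T : {set G}).

Lemma triangle_degree T u : triangle T -> \sum_(v in T) adj u v <= 2.
Proof.
case/triangleP=> x [y [z [-> xy xz yz]]]; rewrite sum_set3 ?adj_neq //.
have := @K4_freeP _ K4f u x y z.
case: (adj u x); case: (adj u y); case: (adj u z) => //.
by move/(_ isT isT isT xy xz yz).
Qed.

(** For [u] outside [T], a second neighbour makes [u] and the third corner saturated; for [u] in
    [T], the last term pays for the second neighbour. *)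
Lemma triangle_degree_saturated T u : triangle T ->
  \sum_(v in T) adj u v <= 1 + \sum_(v in T) saturated u v + (u \in T).
Proof.
move=> tT; have := triangle_degree u tT.
case: (boolP (u \in T)) => [uT /leq_trans|]; first by apply; rewrite addn1 add1n.
case/triangleP: tT=> x [y [z [-> xy xz yz]]]; rewrite !sum_set3 ?adj_neq // !inE.
rewrite !negb_or -andbA => /and3P[ux uy uz]; rewrite addn0.
have yx : adj y x by rewrite adj_sym.
have zx : adj z x by rewrite adj_sym.
have zy : adj z y by rewrite adj_sym.
have sat v w w' : u != v -> adj u v = false -> adj u w = true -> adj u w' = true ->
    adj v w -> adj v w' -> adj w w' -> saturated u v = true.
  by move=> uv /negbT nuv uw uw' vw vw' ww'; apply: (saturatedI uv nuv uw uw').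
case ax: (adj u x); case ay: (adj u y); case az: (adj u z) => //= _.
- by rewrite (sat z x y) //; case: (saturated u x); case: (saturated u y).
- by rewrite (sat y x z) //; case: (saturated u x); case: (saturated u z).
- by rewrite (sat x y z) //; case: (saturated u y); case: (saturated u z).
Qed.

Definition common (F : {set G}) y z := [set u in F | adj y u && adj z u].

Section Triangle.
Variables (x y z : G) (F : {set G}).
Hypotheses (xy : adj x y) (xz : adj x z) (yz : adj y z).

Definition missed := [set u in F | ~~ [|| adj x u, adj y u | adj z u]].

(** A vertex of F has at most two neighbours in the triangle. One is the baseline [#|F|], two put it
    into exactly one common set, none into [missed]. *)
Lemma count_triangle :
  count_pairs (@adj G) [set x; y; z] F + #|missed| =
  #|F| + (#|common F y z| + #|common F x z| + #|common F x y|).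
Proof.
rewrite /count_pairs sum_set3 ?adj_neq // -!sum_mem_bool -sum1_card.
rewrite -!big_split /=; apply: eq_bigr => u _.
have := @K4_freeP _ K4f u x y z; rewrite ![adj u _]adj_sym.
case: (adj x u); case: (adj y u); case: (adj z u) => //.
by move/(_ isT isT isT xy xz yz).
Qed.

Lemma common_saturated u v : u \in common F x y -> v \in common F x y -> u != v ->
  saturated u v.
Proof.
rewrite !inE => /and3P[_ xu yu] /and3P[_ xv yv] uv.
have nuv : ~~ adj u v by apply/negP => auv; apply: (@K4_freeP _ K4f x y u v).
by apply: (saturatedI uv nuv _ _ _ _ xy); rewrite adj_sym.
Qed.

End Triangle.

Lemma common_disjoint F x y z : adj x y -> adj x z -> adj y z ->
  [disjoint common F x y & common F x z].
Proof.
move=> xy xz yz; rewrite -setI_eq0; apply/eqP/setP => u; rewrite !inE.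
apply/negP => /and3P[/and3P[_ xu yu] _ /andP[_ zu]].
by apply: (@K4_freeP _ K4f x y z u).
Qed.

End K4FreeBounds.

(** * The lower bound *)

Section LowerBound.
Variable G : sgraph.
Hypothesis K4f : ~~ has_K4 G.
Implicit Types (x y z u v : G) (A B T F : {set G}) (P : {set {set G}}).

Lemma common_sub F x y : common F x y \subset F.
Proof. by apply/subsetP => u; rewrite inE => /andP[]. Qed.

(** * Exchanging one triangle for two *)

Section Swap.
Variables (F : {set G}) (x y z : G).
Hypotheses (xy : adj x y) (xz : adj x z) (yz : adj y z).
Hypotheses (xF : x \notin F) (yF : y \notin F) (zF : z \notin F).
(** Local form of the maximality of the family: xyz cannot be traded for two disjoint triangles on
    its corners and F. *)
Hypothesis no_two_triangles : forall T1 T2, triangle T1 -> triangle T2 ->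
  [disjoint T1 & T2] -> T1 :|: T2 \subset [set x; y; z] :|: F -> False.

Lemma link_independent : common F y z != set0 ->
  {in F &, forall u v, adj x u -> adj x v -> ~~ adj u v}.
Proof.
case/set0Pn=> w; rewrite inE => /and3P[wF yw zw] u v uF vF xu xv.
apply/negP => uv; have neqF a b : a \notin F -> b \in F -> a != b.
  by move=> aF bF; apply: contraNneq aF => ->.
have xw : ~~ adj x w.
  by apply/negP => xw; apply: (@K4_freeP _ K4f x y z w).
have uw : u != w by apply: contraNneq xw => <-.
have vw : v != w by apply: contraNneq xw => <-.
(* If u and v were adjacent, xuv and wyz could replace xyz in the family. *)
apply: (@no_two_triangles [set x; u; v] [set w; y; z]).
- exact: triangle_set3.
- by apply: triangle_set3; rewrite // adj_sym.
- rewrite -setI_eq0; apply/eqP/setP => a; rewrite !inE; apply/negP.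
  move=> /andP[/orP[/orP[]|] /eqP-> /orP[/orP[]|]]; apply/negP;
  first [exact: adj_neq | exact: neqF | exact: uw | exact: vw | rewrite eq_sym; exact: neqF].
apply/subsetP => a; rewrite !inE.
by move=> /orP[] /orP[/orP[]|] /eqP->; rewrite ?eqxx ?uF ?vF ?wF ?orbT.
Qed.

End Swap.

(** The union [I] of the three classes is independent. A vertex of F outside [I] joined to a corner
    has its neighbours in [I] confined to the class avoiding that corner, hence at most [M] of them;
    a missed vertex has at most [E]. Mantel bounds the edges outside [I]. *)
Lemma rest_edges_bound F x y z M : triangle_free F ->
  adj x y -> adj x z -> adj y z ->
  {in F &, forall u v, adj x u -> adj x v -> ~~ adj u v} ->
  {in F &, forall u v, adj y u -> adj y v -> ~~ adj u v} ->
  {in F &, forall u v, adj z u -> adj z v -> ~~ adj u v} ->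
  #|common F y z| <= M -> #|common F x z| <= M -> #|common F x y| <= M ->
  let E := #|common F y z| + #|common F x z| + #|common F x y| in
  exists2 w, #|F| = E + w &
    2 * count_pairs (@adj G) F F + 4 * M * #|missed x y z F| <=
      4 * (M * w + E * #|missed x y z F|) + w ^ 2.
Proof.
move=> tfF xy xz yz ix iy iz Mx My Mz E.
set X := common F y z in E Mx *; set Y := common F x z in E My *.
set Z := common F x y in E Mz *; set O := missed x y z F.
pose I := X :|: Y :|: Z; pose W := F :\: I.
have IE : #|I| = E.
  have dXY : [disjoint X & Y].
    rewrite /X /Y -setI_eq0; apply/eqP/setP => u; rewrite !inE; apply/negP.
    move=> /andP[/and3P[_ yu zu] /and3P[_ xu _]].
    by apply: (@K4_freeP _ K4f x y z u).
  have dIZ : [disjoint X :|: Y & Z].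
    rewrite -setI_eq0; apply/eqP/setP => u; rewrite !inE; apply/negP.
    move=> /andP[/orP[] /and3P[_ a b] /and3P[_ c d]];
    by apply: (@K4_freeP _ K4f x y z u).
  have cU A B : [disjoint A & B] -> #|A :|: B| = #|A| + #|B|.
    by rewrite -setI_eq0 cardsU => /eqP->; rewrite cards0 subn0.
  by rewrite /I !cU.
have IF : I \subset F by rewrite !subUset !common_sub.
have dIW : [disjoint I & W].
  rewrite -setI_eq0; apply/eqP/setP => u; rewrite /W in_setI in_setD in_set0.
  by case: (u \in I).
have EF : F = I :|: W by rewrite -{1}(setID F I) (setIidPr IF).
exists #|W|; first by rewrite -IE -(cardsID I F) (setIidPr IF).
(* Two vertices of [I], in the same class or not, share a corner as neighbour, and the neighbourhood
   of that corner in F is independent. *)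
have I0 : count_pairs (@adj G) I I = 0.
  apply: count_pairs_eq0 => u v; rewrite !inE.
  move=> /orP[/orP[]|] /and3P[uF u1 u2] /orP[/orP[]|] /and3P[vF v1 v2];
  by first [exact: ix | exact: iy | exact: iz].
have WW : 2 * count_pairs (@adj G) W W <= #|W| ^ 2.
  apply: mantel => a b c; rewrite !inE => /andP[_ aF] /andP[_ bF] /andP[_ cF].
  exact: tfF.
have OW : O \subset W.
  apply/subsetP => u; rewrite !inE => /andP[-> ]; rewrite !negb_or.
  by move=> /and3P[/negPf-> /negPf-> /negPf->].
have cO : \sum_(u in W) (u \in O) = #|O|.
  rewrite sum_mem_bool; congr #|pred_of_set _|; apply/setP => u; rewrite inE.
  by case: (boolP (u \in O)) => uO; rewrite ?andbF // (subsetP OW).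
have WI : count_pairs (@adj G) W I + M * #|O| <= M * #|W| + E * #|O|.
  rewrite -cO !big_distrr /= -[M * #|W|]mulnC -sum_nat_const -!big_split /=.
  apply: leq_sum => u uW.
  case: (boolP (u \in O)) => uO /=.
    rewrite addnC !muln1 leq_add2l -IE -sum1_card; apply: leq_sum => v _.
    by case: (adj u v).
  rewrite !muln0 !addn0 sum_mem_bool.
  have [uF uI] : u \in F /\ u \notin I by move: uW; rewrite !inE => /andP[].
  have split3 : [|| adj x u, adj y u | adj z u].
    by move: uO; rewrite !inE uF /= negbK.
  have sub A : (forall v, v \in I -> adj u v -> v \in A) ->
      #|[set v in I | adj u v]| <= #|A|.
    by move=> h; apply/subset_leq_card/subsetP => v; rewrite inE => /andP[]; exact: h.
  have inI v : v \in I -> v \in F by apply/subsetP.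
  have excl t v : {in F &, forall u v, adj t u -> adj t v -> ~~ adj u v} ->
      adj t u -> v \in I -> adj u v -> adj t v = false.
    by move=> it tu vI uv; apply/negP => tv; have := it u v uF (inI v vI) tu tv; rewrite uv.
  case/or3P: split3 => tu.
  - apply: leq_trans Mx; apply: sub => v vI uv; have := excl x v ix tu vI uv.
    by move: vI; rewrite !inE => /orP[/orP[]|] /and3P[-> a b] c //; rewrite ?a ?b // in c *.
  - apply: leq_trans My; apply: sub => v vI uv; have := excl y v iy tu vI uv.
    by move: vI; rewrite !inE => /orP[/orP[]|] /and3P[-> a b] c //; rewrite ?a ?b // in c *.
  - apply: leq_trans Mz; apply: sub => v vI uv; have := excl z v iz tu vI uv.
    by move: vI; rewrite !inE => /orP[/orP[]|] /and3P[-> a b] c //; rewrite ?a ?b // in c *.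
rewrite (count_pairs_square (@adj_sym G) dIW EF) I0.
move: WI WW; rewrite -/O.
move: (count_pairs _ W I) (count_pairs _ W W) #|W| #|O| => p q w o; clear.
nia.
Qed.

(** * Packings of disjoint triangles *)

Definition packing P := [forall T in P, triangle T] && trivIset P.

Lemma packing_triangle P T : packing P -> T \in P -> triangle T.
Proof. by case/andP=> /forall_inP h _; exact: h. Qed.

Lemma packingU1 P T : packing P -> triangle T -> [disjoint T & cover P] ->
  packing (T |: P) /\ #|T |: P| = #|P|.+1.
Proof.
move=> /andP[/forall_inP tP triv] tT dT; split.
  apply/andP; split.
    by apply/forall_inP => A; rewrite !inE => /orP[/eqP->//|]; exact: tP.
  by apply: trivIsetU; rewrite ?trivIset1 // cover1.
rewrite cardsU1; case: (boolP (T \in P)) => //= TP.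
have /eqP T0 : T == set0.
  rewrite -[T]setIid setI_eq0; apply: disjointWr dT.
  by apply/subsetP => u uT; apply/bigcupP; exists T.
by case/andP: tT; rewrite T0 cards0.
Qed.

Lemma card_packing P : packing P -> #|cover P| = 3 * #|P|.
Proof.
move=> pP; have /andP[_ /eqP <-] := pP.
rewrite mulnC -sum_nat_const; apply: eq_bigr => T TP.
by have /andP[/eqP] := packing_triangle pP TP.
Qed.

(** [T1] and [T2] meet the cover only inside [T], so both can be added once [T] is removed. *)
Lemma packing_swap P T T1 T2 : packing P -> T \in P -> triangle T1 -> triangle T2 ->
  [disjoint T1 & T2] -> T1 :|: T2 \subset T :|: ~: cover P ->
  exists2 P' : {set {set G}}, packing P' & #|P'| = #|P|.+1.
Proof.
move=> pP TP t1 t2 d12; rewrite subUset => /andP[s1 s2].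
have triv : trivIset P by case/andP: pP.
have pD : packing (P :\ T).
  apply/andP; split; last by rewrite trivIsetD.
  by apply/forall_inP => A; rewrite !inE => /andP[_]; exact: packing_triangle.
have dj A : A \subset T :|: ~: cover P -> [disjoint A & cover (P :\ T)].
  move=> sA; rewrite coverD1 // disjoint_subset; apply: subset_trans sA _.
  by apply/subsetP => u; rewrite !inE negb_and negbK.
have [p1 c1] := packingU1 pD t1 (dj _ s1).
have [|p2 c2] := packingU1 p1 t2.
  rewrite /cover bigcup_setU big_set1 disjoints_subset setCU subsetI.
  by rewrite -!disjoints_subset disjoint_sym d12 dj.
by exists (T2 |: (T1 |: P :\ T)); rewrite // c2 c1 (cardsD1 T P) TP.
Qed.

(** Sum [triangle_degree_saturated] over all covered [u] and all [T]: the constants give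
    [3 * #|P| ^ 2], the incidences [u \in T] give [3 * #|P|]. *)
Lemma adj_cover_cover P : packing P ->
  count_pairs (@adj G) (cover P) (cover P) <=
  3 * #|P| ^ 2 + 3 * #|P| + count_pairs (@saturated G) (cover P) (cover P).
Proof.
move=> pP; have /andP[_ triv] := pP; rewrite !count_pairs_coverr //.
have -> : 3 * #|P| ^ 2 + 3 * #|P| = \sum_(T in P) (#|cover P| + 3).
  by rewrite sum_nat_const card_packing //; lia.
rewrite -big_split; apply: leq_sum => T TP /=.
have tT := packing_triangle pP TP.
have -> : 3 = \sum_(u in cover P) (u \in T).
  rewrite sum_mem_bool; case/andP: tT => /eqP <- _; congr #|pred_of_set _|.
  apply/setP => u; rewrite inE; case: (boolP (u \in T)) => uT; rewrite ?andbF // andbT.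
  by apply/esym/bigcupP; exists T.
rewrite -sum1_card -!big_split; apply: leq_sum => u _ /=.
by rewrite addnAC; exact: triangle_degree_saturated.
Qed.

(** A version free of saturated pairs, for the averaging that finds a heavy triangle. *)
Lemma adj_cover_cover_trivial P : packing P ->
  count_pairs (@adj G) (cover P) (cover P) <= 6 * #|P| ^ 2.
Proof.
move=> pP; have /andP[_ triv] := pP; rewrite count_pairs_coverr //.
have -> : 6 * #|P| ^ 2 = \sum_(T in P) \sum_(u in cover P) 2.
  by rewrite !sum_nat_const card_packing //; lia.
apply: leq_sum => T TP; apply: leq_sum => u _.
by apply: triangle_degree => //; exact: packing_triangle TP.
Qed.

Lemma adj_rest_cover P F : packing P -> [disjoint F & cover P] ->
  count_pairs (@adj G) F (cover P) <=
  #|P| * #|F| + count_pairs (@saturated G) F (cover P).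
Proof.
move=> pP dF; have /andP[_ triv] := pP; rewrite !count_pairs_coverr //.
rewrite -sum_nat_const -big_split; apply: leq_sum => T TP /=.
rewrite -sum1_card -big_split; apply: leq_sum => u uF /=.
apply: leq_trans (triangle_degree_saturated K4f u (packing_triangle pP TP)) _.
case: (boolP (u \in T)) => uT; last by rewrite addn0.
have : u \in cover P by apply/bigcupP; exists T.
by move=> uP; have := disjointFr dF uF; rewrite uP.
Qed.

Lemma heavy_triangle P F c d : packing P ->
  c * #|P| < 4 * count_pairs (@adj G) (cover P) F + d * #|P| ->
  exists2 T, T \in P & c < 4 * count_pairs (@adj G) T F + d.
Proof.
move=> pP; have /andP[_ triv] := pP; rewrite count_pairs_coverl // => h.
apply/exists_inP; apply: contraLR h; rewrite negb_exists_in => /forall_inP h.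
rewrite -leqNgt big_distrr -![_ * #|P|]mulnC -!sum_nat_const -big_split /=.
by apply: leq_sum => T /h; rewrite -leqNgt.
Qed.

Lemma many_saturating_edges :
  #|G| ^ 2 < 4 * #|edges G| -> 2 * #|G| ^ 2 <= 33 * (num_K4_saturating G + #|G|).
Proof.
move=> he.
have p0 : packing (set0 : {set {set G}}).
  apply/andP; split; first by apply/forall_inP => T; rewrite inE.
  by apply/trivIsetP => A B; rewrite inE.
case: (arg_maxnP (fun P : {set {set G}} => #|P|) p0) => P pP Pmax.
have triv : trivIset P by case/andP: pP.
set K := cover P; set t := #|P|; pose F := ~: K.
have cK : #|K| = 3 * t by exact: card_packing.
set m := #|F|; set n := #|G|.
have nmt : n = m + 3 * t by rewrite /n /m -cK addnC cardsC.
have dKF : [disjoint K & F] by rewrite /F disjoints_subset setCK.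
have EV : [set: G] = K :|: F by rewrite /F setUCr.
have tfF : triangle_free F.
  move=> x y z xF yF zF; apply/negP => /and3P[xy xz yz].
  have dxyz : [disjoint [set x; y; z] & cover P].
    rewrite disjoints_subset; apply/subsetP => u.
    by rewrite !inE -/K => /orP[/orP[]|] /eqP->; move: xF yF zF; rewrite !inE.
  have [/Pmax] := packingU1 pP (triangle_set3 xy xz yz) dxyz.
  by move=> le eq; move: le; rewrite /= eq ltnn.
have swap T T1 T2 : T \in P -> triangle T1 -> triangle T2 -> [disjoint T1 & T2] ->
    T1 :|: T2 \subset T :|: F -> False.
  move=> TP t1 t2 d12 s12; have [P' /Pmax + eq] := packing_swap pP TP t1 t2 d12 s12.
  by rewrite /= eq ltnn.
have eV := card_edges G.
have sV := num_K4_saturatingE K4f.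
have := count_pairs_square (@adj_sym G) dKF EV; rewrite -eV => eV'.
have := count_pairs_square (@saturated_sym G) dKF EV; rewrite -sV => sV'.
have KK := adj_cover_cover pP; have KK2 := adj_cover_cover_trivial pP; rewrite -/K -/t in KK KK2.
have dFK : [disjoint F & cover P] by rewrite disjoint_sym.
have FK := adj_rest_cover pP dFK; rewrite -/K -/t -/m in FK.
have FF := mantel tfF; rewrite -/m in FF.
set sFF := count_pairs _ F F in sV'.
set s := count_pairs _ K K + 2 * count_pairs _ F K in sV'.
have hs : n ^ 2 <= 2 * s + 6 * t ^ 2 + 6 * t + 4 * t * m + 2 * count_pairs (@adj G) F F.
  rewrite /s; move: he eV' KK FK; rewrite -/n; lia.
have hS : 2 * num_K4_saturating G >= s + sFF by rewrite sV'.
(* With at most [6 * t ^ 2] ordered adjacent pairs inside the packing and Mantel inside [F], the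
   edge count gives [6 * m * t < 4 * count_pairs (@adj G) F K + 3 * t ^ 2]; then average over the
   [t] triangles. *)
have [T TP heavy] : exists2 T, T \in P & 6 * m < 4 * count_pairs (@adj G) T F + 3 * t.
  apply: heavy_triangle => //; rewrite -/K -/t count_pairsC; last exact: adj_sym.
  move: he eV' KK2 FF; rewrite -/n nmt.
  move: (count_pairs _ F K) (count_pairs _ K K) (count_pairs _ F F) #|edges G|.
  clear -m t; move: m t => m' t' a b c e h1 h2 h3 h4.
  nia.
have tT := packing_triangle pP TP.
case/triangleP: tT => x [y [z [ET xy xz yz]]].
have KT : T \subset K by apply/subsetP => u uT; apply/bigcupP; exists T.
have notF u : u \in T -> u \notin F by move=> /(subsetP KT) uK; rewrite inE negbK.
have xF : x \notin F by apply: notF; rewrite ET !inE eqxx.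
have yF : y \notin F by apply: notF; rewrite ET !inE eqxx orbT.
have zF : z \notin F by apply: notF; rewrite ET !inE eqxx orbT.
have yx : adj y x by rewrite adj_sym.
have zx : adj z x by rewrite adj_sym.
have zy : adj z y by rewrite adj_sym.
have cT := count_triangle K4f F xy xz yz; rewrite -ET -/m in cT.
have lx : common F y z != set0 -> {in F &, forall u v, adj x u -> adj x v -> ~~ adj u v}.
  apply: link_independent => // T1 T2 t1 t2 d12; rewrite -ET; exact: swap TP t1 t2 d12.
have ly : common F x z != set0 -> {in F &, forall u v, adj y u -> adj y v -> ~~ adj u v}.
  apply: link_independent => // T1 T2 t1 t2 d12.
  have -> : [set y; x; z] = T by rewrite ET (setUC [set y]).
  exact: swap TP t1 t2 d12.
have lz : common F x y != set0 -> {in F &, forall u v, adj z u -> adj z v -> ~~ adj u v}.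
  apply: link_independent => // T1 T2 t1 t2 d12.
  have -> : [set z; x; y] = T by rewrite ET -setUA setUC.
  exact: swap TP t1 t2 d12.
have symc a b : common F a b = common F b a.
  by apply/setP => u; rewrite !inE [adj b u && _]andbC.
have dXY : [disjoint common F y z & common F x z].
  by rewrite ![common F _ z]symc; exact: common_disjoint.
have dXYZ : [disjoint common F y z :|: common F x z & common F x y].
  rewrite -setI_eq0 setIUl setU_eq0 !setI_eq0; apply/andP; split.
    by rewrite (symc x y); apply: common_disjoint => //; rewrite adj_sym.
  by apply: common_disjoint => //; rewrite adj_sym.
have cl a b : adj a b -> #|common F a b| ^ 2 <=
    count_pairs (@saturated G) (common F a b) (common F a b) + #|common F a b|.
  by move=> ab; apply: count_pairs_clique => u v; exact: common_saturated.
have satF : #|common F y z| ^ 2 + #|common F x z| ^ 2 + #|common F x y| ^ 2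
    <= sFF + (#|common F y z| + #|common F x z| + #|common F x y|).
  have h1 := count_pairs_disjoint (@saturated_sym G) dXY (subxx _).
  have h2 : _ <= sFF := count_pairs_disjoint (@saturated_sym G) dXYZ _.
  have := h2 ltac:(by rewrite !subUset !common_sub).
  by move: h1 (cl y z yz) (cl x z xz) (cl x y xy); clear; lia.
set X := common F y z in cT lx dXY dXYZ satF *.
set Y := common F x z in cT ly dXY dXYZ satF *.
set Z := common F x y in cT lz dXYZ satF *.
have Em : #|X| + #|Y| + #|Z| <= m.
  have : X :|: Y :|: Z \subset F by rewrite !subUset !common_sub.
  move/subset_leq_card; rewrite -/m !cardsU.
  by move: dXYZ dXY; rewrite -!setI_eq0 => /eqP-> /eqP->; rewrite cards0 !subn0.
have hE : 2 * m + 4 * #|missed x y z F| <= 4 * (#|X| + #|Y| + #|Z|) + 3 * t.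
  exact: weight_balance cT heavy.
(* [link_independent] needs the opposite class to be nonempty; with an empty class only Mantel's
   bound on [F] is used. *)
case: (boolP [|| X == set0, Y == set0 | Z == set0]) => [some0|].
  apply: (two_class_nat nmt hS hs FF _ Em); first exact: leq_trans (leq_addr _ _) hE.
  by apply: sqrn_sum_two satF _; rewrite -!cards_eq0 in some0 *.
rewrite !negb_or => /and3P[/lx ix /ly iy /lz iz].
have leM a b c : [/\ a <= maxn a (maxn b c), b <= maxn a (maxn b c) & c <= maxn a (maxn b c)].
  by rewrite !leq_max !leqnn !orbT.
have [aM bM cM] := leM #|X| #|Y| #|Z|.
have [w mw bw] := rest_edges_bound tfF xy xz yz ix iy iz aM bM cM.
exact: three_class_max_nat nmt hS hs FF hE mw satF bw.
Qed.

End LowerBound.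

(** * The upper bound *)

Lemma mem_edges (H : sgraph) (x y : H) : ([set x; y] \in edges H) = adj x y.
Proof.
apply/imsetP/idP => [[[u v]]|xy]; last by exists (x, y); rewrite ?inE.
rewrite inE /= => uv E.
have : u \in [set x; y] by rewrite E !inE eqxx.
have : v \in [set x; y] by rewrite E !inE eqxx orbT.
have uv' := adj_neq uv.
rewrite !inE => /orP[]/eqP vE /orP[]/eqP uE; move: uv uv'; rewrite vE uE ?eqxx //.
by rewrite adj_sym.
Qed.

(** * Deleting surplus edges *)

Section Subgraph.
Variables (G : sgraph) (B : {set {set G}}).

Definition sub_adj : rel G := fun x y => (x != y) && ([set x; y] \in B).

Lemma sub_adj_sym : symmetric sub_adj.
Proof. by move=> x y; rewrite /sub_adj eq_sym setUC. Qed.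

Lemma sub_adj_irrefl : irreflexive sub_adj.
Proof. by move=> x; rewrite /sub_adj eqxx. Qed.

Definition subgraph : sgraph := SGraph sub_adj_sym sub_adj_irrefl.

Hypothesis BE : B \subset edges G.

Lemma sub_adj_adj x y : sub_adj x y -> adj x y.
Proof. by case/andP=> _ /(subsetP BE); rewrite mem_edges. Qed.

Lemma edges_subgraph : edges subgraph = B.
Proof.
apply/setP => e; apply/imsetP/idP => [[[x y]]|eB].
  by rewrite inE /= => /andP[_ xyB] ->.
have /imsetP[[x y]] := subsetP BE e eB; rewrite inE /= => xy eE.
by exists (x, y); rewrite // inE /= /sub_adj -eE eB (adj_neq xy).
Qed.

Lemma K4_free_subgraph : ~~ has_K4 G -> ~~ has_K4 subgraph.
Proof.
apply: contra => /existsP[A /andP[A4 /forall_inP cA]].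
apply/existsP; exists A; apply/andP; split=> //.
apply/forall_inP => x xA; apply/forall_inP => y yA; apply/implyP => xy.
by apply: sub_adj_adj; move: (cA x xA) => /forall_inP/(_ y yA)/implyP/(_ xy).
Qed.

(** A pair saturated in the subgraph stays non-adjacent in [G]: otherwise it would form a K4 of [G]
    with its witnesses. *)
Lemma num_K4_saturating_subgraph : ~~ has_K4 G ->
  num_K4_saturating subgraph <= num_K4_saturating G.
Proof.
move=> K4f; rewrite -(leq_pmul2l (isT : 0 < 2)) !num_K4_saturatingE //; last first.
  exact: K4_free_subgraph.
have sub (x y : G) : saturated (G := subgraph) x y -> saturated (G := G) x y.
  case/and3P=> xy _ /existsP[u /existsP[v /and5P[xu xv yu yv uv]]].
  have {}xu := sub_adj_adj xu; have {}xv := sub_adj_adj xv; have {}uv := sub_adj_adj uv.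
  have {}yu := sub_adj_adj yu; have {}yv := sub_adj_adj yv.
  have nxy : ~~ adj x y.
    by apply/negP => axy; apply: (@K4_freeP _ K4f x y u v).
  have {}xy : x != y := xy.
  exact: (@saturatedI G x y u v xy nxy xu xv yu yv uv).
apply: leq_sum => x _; apply: leq_sum => y _.
by case: (boolP (saturated (G := subgraph) x y)) => // /sub ->.
Qed.

End Subgraph.

Lemma exists_subset_card (T : finType) (A : {set T}) e : e <= #|A| ->
  exists2 B : {set T}, B \subset A & #|B| = e.
Proof.
move=> eA; exists [set x in take e (enum A)].
  by apply/subsetP => x; rewrite inE => /mem_take; rewrite mem_enum.
rewrite cardsE (card_uniqP _) ?take_uniq ?enum_uniq // size_takel //.
by rewrite -cardE.
Qed.

(** * The tripartite construction *)

Section Construction.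
Variables p q z k : nat.
Hypotheses (kp : k <= p) (kq : k <= q).

Definition tripartite_vertex : finType := ('I_p + 'I_q + 'I_z)%type.

(* The parts 0, 1, 2 are P, Q, Z; the inner vertices are those of Z and the k vertices of each
   of P and Q that are joined to Z. *)
Definition part (x : tripartite_vertex) : 'I_3 :=
  match x with
  | inl (inl _) => @Ordinal 3 0 isT
  | inl (inr _) => @Ordinal 3 1 isT
  | inr _ => @Ordinal 3 2 isT
  end.

Definition inner (x : tripartite_vertex) : bool :=
  match x with inl (inl i) => i < k | inl (inr j) => j < k | inr _ => true end.

Definition tripartite_adj : rel tripartite_vertex := fun x y => (part x != part y) &&
  ((part x != @Ordinal 3 2 isT) && (part y != @Ordinal 3 2 isT) || inner x && inner y).

Lemma tripartite_adj_sym : symmetric tripartite_adj.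
Proof.
by move=> x y; rewrite /tripartite_adj eq_sym [inner x && _]andbC [(part x != _) && _]andbC.
Qed.

Lemma tripartite_adj_irrefl : irreflexive tripartite_adj.
Proof. by move=> x; rewrite /tripartite_adj eqxx. Qed.

Definition tripartite_graph : sgraph := SGraph tripartite_adj_sym tripartite_adj_irrefl.

Lemma card_tripartite_graph : #|tripartite_graph| = p + q + z.
Proof. by rewrite !card_sum !card_ord. Qed.

(** [part] is a proper 3-colouring. *)
Lemma tripartite_graph_K4_free : ~~ has_K4 tripartite_graph.
Proof.
apply/negP => /existsP[A /andP[/eqP A4 /forall_inP cA]].
have injA : {in A &, injective part}.
  move=> x y xA yA pxy; apply/eqP; apply: contraT => xy.
  move: (cA x xA) => /forall_inP/(_ y yA)/implyP/(_ xy).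
  by rewrite /= /tripartite_adj pxy eqxx.
have := max_card (mem (part @: A)).
by rewrite card_in_imset // A4 card_ord.
Qed.

(** The witnesses occupy two different parts, so [x] and [y] share the third. One of the three parts
    is Z, and an edge at Z has both ends inner. *)
Lemma tripartite_graph_saturated (x y : tripartite_graph) : saturated x y ->
  [&& part x == part y, inner x & inner y].
Proof.
case/and3P=> _ _ /existsP[u /existsP[v /and5P[]]]; rewrite /= /tripartite_adj.
have three (a b c d : 'I_3) : a != c -> a != d -> b != c -> b != d -> c != d -> a = b.
  case: a b c d => [a ?] [b ?] [c ?] [d ?]; rewrite -!val_eqE /= => *.
  by apply: val_inj => /=; lia.
have two (a c d : 'I_3) : a != c -> a != d -> c != d ->
    [|| a == @Ordinal 3 2 isT, c == @Ordinal 3 2 isT | d == @Ordinal 3 2 isT].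
  by case: a c d => [a ?] [c ?] [d ?]; rewrite -!val_eqE /=; lia.
move=> /andP[xu i1] /andP[xv i2] /andP[yu i3] /andP[yv i4] /andP[uv _].
have xy := three _ _ _ _ xu xv yu yv uv; rewrite xy eqxx /=.
move: i1 i2 i3 i4; rewrite xy; case/or3P: (two _ _ _ yu yv uv) => /eqP->;
  rewrite eqxx ?andbF /=.
- by move=> /andP[-> _] _ /andP[->].
- by move=> /andP[-> _] _ /andP[->].
- by move=> _ /andP[-> _] _ /andP[->].
Qed.

Lemma sum_ltn_ord n : k <= n -> \sum_(i < n) (i < k) = k.
Proof.
move=> kn; rewrite -[RHS]card_ord -sum1_card (big_ord_widen n (fun=> 1) kn).
by rewrite [RHS]big_mkcond; apply: eq_bigr => i _; case: (i < k).
Qed.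

Lemma sum_tripartite (f : tripartite_vertex -> nat) : \sum_(x : tripartite_vertex) f x =
  \sum_(i < p) f (inl (inl i)) + \sum_(i < q) f (inl (inr i)) + \sum_(i < z) f (inr i).
Proof. by rewrite !big_sumType. Qed.

Lemma card_edges_tripartite_graph : #|edges tripartite_graph| = p * q + 2 * k * z.
Proof.
apply/eqP; rewrite -(eqn_pmul2l (isT : 0 < 2)) card_edges /count_pairs; apply/eqP.
have row0 i : \sum_(y : tripartite_vertex) tripartite_adj (inl (inl i)) y = q + (i < k) * z.
  rewrite sum_tripartite /tripartite_adj /= !sum_nat_const !card_ord.
  by case: (i < k) => /=; clear; lia.
have row1 i : \sum_(y : tripartite_vertex) tripartite_adj (inl (inr i)) y = p + (i < k) * z.
  rewrite sum_tripartite /tripartite_adj /= !sum_nat_const !card_ord.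
  by case: (i < k) => /=; clear; lia.
have row2 i : \sum_(y : tripartite_vertex) tripartite_adj (inr i) y = k + k.
  by rewrite sum_tripartite /tripartite_adj /= !sum_ltn_ord // sum_nat_const muln0 addn0.
transitivity (\sum_(x : tripartite_vertex) \sum_(y : tripartite_vertex) tripartite_adj x y).
  by apply: eq_big => [x|x _]; rewrite ?inE //; apply: eq_bigl => y; rewrite inE.
rewrite sum_tripartite (eq_bigr _ (fun i _ => row0 i)) (eq_bigr _ (fun i _ => row1 i)).
rewrite (eq_bigr _ (fun i _ => row2 i)) !big_split /= -!big_distrl /= !sum_ltn_ord //.
by rewrite !sum_nat_const !card_ord; lia.
Qed.

(** The right side counts all ordered pairs, diagonal included, of inner vertices in a common
    part. *)
Lemma num_K4_saturating_tripartite_graph :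
  2 * num_K4_saturating tripartite_graph <= 2 * k ^ 2 + z ^ 2.
Proof.
rewrite num_K4_saturatingE ?tripartite_graph_K4_free //.
pose sat (x y : tripartite_vertex) := [&& part x == part y, inner x & inner y].
have row0 i : \sum_(y : tripartite_vertex) sat (inl (inl i)) y = (i < k) * k.
  rewrite sum_tripartite /sat /= !sum_nat_const !muln0 !addn0.
  by case: (i < k); rewrite /= ?sum_ltn_ord ?mul1n // sum_nat_const muln0.
have row1 i : \sum_(y : tripartite_vertex) sat (inl (inr i)) y = (i < k) * k.
  rewrite sum_tripartite /sat /= !sum_nat_const !muln0 addn0 add0n.
  by case: (i < k); rewrite /= ?sum_ltn_ord ?mul1n // sum_nat_const muln0.
have row2 i : \sum_(y : tripartite_vertex) sat (inr i) y = z.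
  by rewrite sum_tripartite /sat /= !sum_nat_const !muln0 !add0n card_ord muln1.
apply: (@leq_trans (\sum_(x : tripartite_vertex) \sum_(y : tripartite_vertex) sat x y)).
  rewrite /count_pairs (eq_bigl xpredT) => [|x]; last by rewrite inE.
  apply: leq_sum => x _.
  rewrite (eq_bigl xpredT) => [|y]; last by rewrite inE.
  apply: leq_sum => y _.
  case: (boolP (saturated (G := tripartite_graph) x y)) => //.
  by move/tripartite_graph_saturated; rewrite /sat => ->.
rewrite sum_tripartite (eq_bigr _ (fun i _ => row0 i)) (eq_bigr _ (fun i _ => row1 i)).
rewrite (eq_bigr _ (fun i _ => row2 i)) -!big_distrl /= !sum_ltn_ord //.
by rewrite !sum_nat_const !card_ord; lia.
Qed.

End Construction.

Lemma few_saturating_edges n : 73 <= n ->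
  exists G : sgraph, [/\ #|G| = n, #|edges G| = n ^ 2 %/ 4 + 1, ~~ has_K4 G &
    33 * num_K4_saturating G <= 2 * n ^ 2 + 66 * n].
Proof.
move=> n73.
pose z := 2 * n %/ 33; pose p := (n - z) %/ 2; pose q := n - z - p.
(* As [4 * p * q] is about [(n - z) ^ 2], reaching [n ^ 2] takes [8 * k] about [2 * n - z]; the
   added 2 covers all rounding. *)
pose k := (2 * n - z) %/ 8 + 2.
have hz : 33 * z <= 2 * n < 33 * z + 33 by rewrite /z; lia.
have hp : 2 * p <= n - z < 2 * p + 2 by rewrite /p; lia.
have hq : n = p + q + z by rewrite /q; lia.
have hk : 8 * k <= 2 * n - z + 16 < 8 * k + 8 by rewrite /k; lia.
clearbody z p q k.
have kp : k <= p by lia.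
have kq : k <= q by lia.
pose H := tripartite_graph p q z k.
have K4H : ~~ has_K4 H by exact: tripartite_graph_K4_free.
have eH : n ^ 2 %/ 4 + 1 <= #|edges H|.
  rewrite card_edges_tripartite_graph //.
  suff : n ^ 2 + 4 <= 4 * (p * q + 2 * k * z) by lia.
  (* The slack 9, multiplied by [z], pays for the additive 4 and for [p] and [q] differing by
     one. *)
  have [zk qp] : 4 * p + z + 9 <= 8 * k /\ (q = p \/ q = p.+1) by lia.
  have {zk} := leq_mul zk (leqnn z).
  have : 2 <= z by lia.
  rewrite hq; case: qp => ->; clear; nia.
have sH : 33 * num_K4_saturating H <= 2 * n ^ 2 + 66 * n.
  have := num_K4_saturating_tripartite_graph z kp kq; rewrite -/H.
  move: (num_K4_saturating H) => S hS.
  (* Up to bounded terms [k = 4 * z], so [2 * k ^ 2 + z ^ 2] is about [33 * z ^ 2], and 33 times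
     half of it about [(2 * n) ^ 2 / 2]. The remainder [d] tracks the rounding of [z]. *)
  have [d hd d32] : exists2 d, 2 * n = 33 * z + d & d <= 32 by exists (2 * n - 33 * z); lia.
  have k8 : 8 * k <= 32 * z + d + 16 by lia.
  have k2 := leq_mul k8 k8; have d2 := leq_mul d32 (leqnn d).
  have n2 : 4 * n ^ 2 = (33 * z + d) ^ 2 by rewrite -hd expnMn.
  have z2 : 2 <= z by lia.
  move: hS k2 d2 n2 hd z2; clear; lia.
have [B BE cB] := exists_subset_card eH.
exists (subgraph B); split.
- by rewrite card_tripartite_graph.
- by rewrite edges_subgraph.
- exact: K4_free_subgraph.
by apply: leq_trans sH; rewrite leq_mul2l num_K4_saturating_subgraph.
Qed.

(** * The asymptotic formula *)

Local Open Scope ring_scope.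

Theorem theorem1 (R : realType) :
  exists2 C : R, 0 < C &
    forall n : nat, (73 <= n)%N ->
      exists2 l : nat, is_min_K4_saturating n (n ^ 2 %/ 4 + 1)%N l &
        `|l%:R - 2 * n%:R ^+ 2 / 33| <= C * n%:R.
Proof.
(* Both bounds below have error [66 * n] in [33 * l], whence the constant 2. *)
exists 2 => // n n73; have [G [Gn Ge K4f Gs]] := few_saturating_edges n73.
pose e := (n ^ 2 %/ 4 + 1)%N.
(* A largest bound exists: 0 is a bound, and the constructed graph caps all bounds. *)
have bound0 : exists l, `[< K4_saturating_bound n e l >].
  by exists 0%N; apply/asboolP => H.
have ub l : `[< K4_saturating_bound n e l >] -> (l <= num_K4_saturating G)%N.
  by move/asboolP; apply.
case: (ex_maxnP bound0 ub) => l /asboolP lb lmax; exists l.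
  by split=> // l' lb'; apply: lmax; apply/asboolP.
(* The floor costs less than 33 in [33 * l], which doubling the error [33 * n] covers. *)
have low : ((2 * n ^ 2 - 33 * n) %/ 33 <= l)%N.
  apply: lmax; apply/asboolP => H Hn He K4H.
  have := many_saturating_edges K4H; rewrite Hn He /e => /(_ ltac:(lia)).
  lia.
have up : (33 * l <= 2 * n ^ 2 + 66 * n)%N.
  by apply: leq_trans Gs; rewrite leq_mul2l ub //; apply/asboolP.
have {}low : (2 * n ^ 2 <= 33 * l + 66 * n)%N by lia.
move: up low; rewrite -!(ler_nat R) !(natrD, natrM, natrX) => up low.
by rewrite ler_norml; apply/andP; split; lra.
Qed.
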